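(* Let $q$ be a real number with $0<|q|<1$, $d$ a positive integer and $0\le k\le n$ integers. Then $$\left\langle \begin{matrix} n\\ k\end{matrix}\right\rangle_{d,q}=q^{-\binom{d}{2}(n-k)}\det\left(\begin{bmatrix} n+i\\ k+j\end{bmatrix}_q\right)_{i,j=0}^{d-1}.$$
   Context: For integers $0\le k\le m$, the $q$-binomial coefficient is $\begin{bmatrix} m\\ k\end{bmatrix}_q=\prod_{j=0}^{k-1}\frac{1-q^{m-j}}{1-q^{k-j}}$, and $\begin{bmatrix} m\\ k\end{bmatrix}_q=0$ if $k<0$ or $k>m$. The $q$-Hoggatt coefficient is, for $0\le k\le n$, $$\left\langle \begin{matrix} n\\ k\end{matrix}\right\rangle_{d,q}=\prod_{j=0}^{k-1}\frac{\begin{bmatrix} n-j+d-1\\ d\end{bmatrix}_q}{\begin{bmatrix} k-j+d-1\\ d\end{bmatrix}_q}.$$ *)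

(* Defs.v *)
From HB Require Import structures.
From mathcomp Require Import all_boot all_order all_algebra.

Set Implicit Arguments.
Unset Strict Implicit.
Unset Printing Implicit Defensive.

Import Order.TTheory GRing.Theory Num.Theory.
Local Open Scope ring_scope.

(* The lower index is a natural number, so the convention that the coefficient
   vanishes for negative k has no counterpart here. Division is the total
   division of F: the definition has its usual meaning when q ^+ i != 1 for
   0 < i <= k, which holds for every k as soon as 0 < `|q| < 1. *)
Definition qbinom (F : fieldType) (q : F) (m k : nat) : F :=
  if (k <= m)%N then
    \prod_(j < k) ((1 - q ^+ (m - j)) / (1 - q ^+ (k - j)))
  else 0.

(* Meant for 0 < d and k <= n: for j < k <= n, the truncated natural number
   subtractions in the upper indices are then exact. *)
Definition qhoggatt (F : fieldType) (d : nat) (q : F) (n k : nat) : F :=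
  \prod_(j < k) (qbinom q (n - j + d - 1) d / qbinom q (k - j + d - 1) d).

(* Main.v *)
(** Writing (q)_m for the product of the 1 - q^i, 1 <= i <= m, the entry
    [n+i, k+j] equals (q)_(n+i) / ((q)_(k+j) (q)_(n-k+i)) times P_j(q^(n-k+i)),
    where P_j(x) = \prod_(t < j) (1 - q^(-t) x); the zeros of P_j account for
    the entries with k+j > n+i.  Rows and columns factor out, and since P_j has
    degree at most j, the matrix (P_j(q^(m+i))) is a Vandermonde matrix times a
    matrix independent of m.  Hence its determinant is q^(m C(d,2)) times the
    value at m = 0, where the matrix is triangular with diagonal (q)_i. *)
Require Import Defs.
From HB Require Import structures.
From mathcomp Require Import all_boot all_order all_algebra.
From mathcomp Require Import ring zify.

Set Implicit Arguments.
Unset Strict Implicit.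
Unset Printing Implicit Defensive.

Import Order.TTheory GRing.Theory Num.Theory.
Local Open Scope ring_scope.

Section QHoggattDeterminant.

Variables (F : fieldType) (q : F).
(** Nonvanishing of q gives meaning to the powers q^(-t); q not being a root of unity keeps every
    denominator below nonzero. *)
Hypothesis q_neq0 : q != 0.
Hypothesis q_nroot : forall i, (0 < i)%N -> q ^+ i != 1.

Definition qfact m : F := \prod_(i < m) (1 - q ^+ i.+1).

Lemma qfact0 : qfact 0 = 1.
Proof. by rewrite /qfact big_ord0. Qed.

Lemma qfactS m : qfact m.+1 = qfact m * (1 - q ^+ m.+1).
Proof. by rewrite /qfact big_ord_recr. Qed.

Lemma qfact_neq0 m : qfact m != 0.
Proof. by apply/prodf_neq0 => i _; rewrite subr_eq0 eq_sym q_nroot. Qed.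

Lemma prod_qfact m k : (k <= m)%N ->
  \prod_(j < k) (1 - q ^+ (m - j)) = qfact m / qfact (m - k).
Proof.
elim: k => [|k IH] le_km; first by rewrite big_ord0 subn0 divff ?qfact_neq0.
rewrite big_ord_recr /= IH 1?ltnW //.
have ->: (m - k = (m - k.+1).+1)%N by lia.
have := qfact_neq0 (m - k.+1).+1; rewrite qfactS mulf_eq0 => /norP[nz1 nz2].
by field; rewrite nz1 nz2.
Qed.

Lemma qbinomE m k : (k <= m)%N ->
  qbinom q m k = qfact m / (qfact k * qfact (m - k)).
Proof.
move=> le_km; rewrite /qbinom le_km big_split /= prodfV !prod_qfact // subnn qfact0 divr1.
by field; rewrite !qfact_neq0.
Qed.

(** The polynomial P_j, with roots 1, q, ..., q^(j-1). *)
Definition qfall j : {poly F} := \prod_(t < j) (1 - q ^- t *: 'X).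

Lemma qfall_horner j x : (qfall j).[x] = \prod_(t < j) (1 - q ^- t * x).
Proof. by rewrite horner_prod; apply: eq_bigr => t _; rewrite !hornerE. Qed.

Lemma size_qfall j : (size (qfall j) <= j.+1)%N.
Proof.
elim: j => [|j IH]; first by rewrite /qfall big_ord0 size_poly1.
rewrite /qfall big_ord_recr /=; apply: leq_trans (size_polyMleq _ _) _.
have le2 : (size (1 - q ^- j *: 'X)%R <= 2)%N.
  apply: leq_trans (size_polyD _ _) _.
  rewrite size_polyN size_poly1 geq_max /=.
  by apply: leq_trans (size_scale_leq _ _) _; rewrite size_polyX.
by move: IH le2; rewrite /qfall; move: (size _) (size _) => a b; lia.
Qed.

Lemma qfall_expr j m : (j <= m)%N ->
  (qfall j).[q ^+ m] = qfact m / qfact (m - j).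
Proof.
move=> le_jm; rewrite qfall_horner -prod_qfact //; apply: eq_bigr => t _.
have lt_tm : (t <= m)%N by apply: leq_trans (ltnW (ltn_ord t)) le_jm.
by rewrite expfB_cond ?(negPf q_neq0) // mulrC.
Qed.

Lemma qfall_expr_eq0 j m : (m < j)%N -> (qfall j).[q ^+ m] = 0.
Proof.
move=> lt_mj; rewrite qfall_horner (bigD1 (Ordinal lt_mj)) //=.
by rewrite mulVf ?expf_neq0 // subrr mul0r.
Qed.

(** Writing n = m + k avoids truncated subtraction. For j > m + i both sides vanish, the right one
    because q^(m+i) is a root of P_j. *)
Lemma qbinom_qfall m k i j :
  qbinom q (m + k + i) (k + j) =
    qfact (m + k + i) / qfact (m + i) * (qfall j).[q ^+ (m + i)] *
      (qfact (k + j))^-1.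
Proof.
have [le_j | lt_j] := leqP j (m + i).
  rewrite qbinomE; last by lia.
  rewrite qfall_expr // (_ : m + k + i - (k + j) = m + i - j)%N; last by lia.
  by field; rewrite !qfact_neq0.
rewrite qfall_expr_eq0 // mulr0 mul0r /qbinom ifN //; lia.
Qed.

Lemma det_scale_rows_cols d (u v : 'I_d -> F) (A : 'I_d -> 'I_d -> F) :
  \det (\matrix_(i, j) (u i * A i j * v j)) =
    \prod_i u i * \det (\matrix_(i, j) A i j) * \prod_i v i.
Proof.
have ->: \matrix_(i, j) (u i * A i j * v j) =
    diag_mx (\row_i u i) *m (\matrix_(i, j) A i j) *m diag_mx (\row_i v i).
  by apply/matrixP=> i j; rewrite mul_mx_diag mul_diag_mx !mxE.
rewrite !det_mulmx !det_diag.
by congr (_ * _ * _); apply: eq_bigr => i _; rewrite mxE.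
Qed.

Lemma det_qfall0 d :
  \det (\matrix_(i < d, j < d) (qfall j).[q ^+ i]) = \prod_(i < d) qfact i.
Proof.
rewrite det_trig; last first.
  by apply/is_trig_mxP=> i j lt_ij; rewrite mxE qfall_expr_eq0.
apply: eq_bigr => i _.
by rewrite mxE qfall_expr // subnn qfact0 divr1.
Qed.

Lemma det_qfall_shift d m :
  \det (\matrix_(i < d, j < d) (qfall j).[q ^+ (m + i)]) =
    q ^+ ('C(d, 2) * m) * \det (\matrix_(i < d, j < d) (qfall j).[q ^+ i]).
Proof.
pose U := \matrix_(l < d, j < d) (qfall j)`_l.
have factor p : \matrix_(i < d, j < d) (qfall j).[q ^+ (p + i)] =
    (* A Vandermonde matrix with column l scaled by q^(lp); the factor 1 fits the form of
       [det_scale_rows_cols]. *)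
    (\matrix_(i < d, l < d) (1 * (q ^+ i) ^+ l * q ^+ (l * p))) *m U.
  apply/matrixP=> i j; rewrite !mxE (@horner_coef_wide _ d); last first.
    exact: leq_trans (size_qfall _) (ltn_ord j).
  apply: eq_bigr => l _; rewrite !mxE mul1r mulrC -!exprM -exprD.
  by congr (q ^+ _ * _); lia.
(* The cases p = m and p = 0 differ only in the column scalings, whose exponents l sum to C(d,2). *)
rewrite factor (factor 0) !det_mulmx !det_scale_rows_cols.
rewrite -!(big_morph _ (@exprD _ q) (expr0 q)) -!big_distrl /=.
by rewrite muln0 -bin2_sum big_mkord; ring.
Qed.

Lemma prod_qfact_ratio d k :
  \prod_(i < d) (qfact (k + i).+1 / qfact (k + i)) = qfact (k + d) / qfact k.
Proof.
elim: d => [|d IH]; first by rewrite big_ord0 addn0 divff ?qfact_neq0.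
rewrite big_ord_recr /= IH addnS.
by field; rewrite !qfact_neq0.
Qed.

(** Both sides are the double product of (1 - q^(m+i+j+1)) / (1 - q^(i+j+1)) over i < d and j < k,
    grouped by j on the left and by i on the right. *)
Lemma qhoggatt_qfact d m k :
  qhoggatt d q (m + k) k =
    \prod_(i < d) (qfact (m + k + i) * qfact i /
                     (qfact (m + i) * qfact (k + i))).
Proof.
transitivity (\prod_(j < k) (qfact (m + j + d) * qfact j /
                               (qfact (m + j) * qfact (j + d)))).
  (* Reversing j turns k - j into j + 1. *)
  rewrite /qhoggatt (reindex_inj rev_ord_inj) /=; apply: eq_bigr => j _.
  have lt_jk := ltn_ord j.
  rewrite (_ : m + k - (k - j.+1) + d - 1 = m + j + d)%N; last by lia.
  rewrite (_ : k - (k - j.+1) + d - 1 = j + d)%N; last by lia.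
  rewrite !qbinomE ?leq_addl // !addnK.
  by field; rewrite !qfact_neq0.
elim: k => [|k IH].
  rewrite big_ord0 big1 // => i _; rewrite addn0 add0n.
  by rewrite divff // mulf_neq0 ?qfact_neq0.
(* Passing from k to k + 1 multiplies factor i by ratios whose products over i telescope. *)
have step i :
    qfact (m + k.+1 + i) * qfact i / (qfact (m + i) * qfact (k.+1 + i)) =
    qfact (m + k + i) * qfact i / (qfact (m + i) * qfact (k + i)) *
    ((qfact (m + k + i).+1 / qfact (m + k + i)) /
     (qfact (k + i).+1 / qfact (k + i))).
  by rewrite addnS !addSn; field; rewrite !qfact_neq0.
rewrite big_ord_recr /= IH (eq_bigr _ (fun i _ => step (nat_of_ord i))).
rewrite [RHS]big_split /=; congr (_ * _).
rewrite big_split /= prodfV !prod_qfact_ratio.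
by field; rewrite !qfact_neq0.
Qed.

Lemma det_qbinom d m k :
  \det (\matrix_(i < d, j < d) qbinom q (m + k + i) (k + j)) =
    q ^+ ('C(d, 2) * m) * qhoggatt d q (m + k) k.
Proof.
under eq_mx do rewrite qbinom_qfall.
rewrite (det_scale_rows_cols (fun i => qfact (m + k + i) / qfact (m + i))
  (fun j => (qfact (k + j))^-1) (fun i j => (qfall j).[q ^+ (m + i)])).
rewrite det_qfall_shift det_qfall0 qhoggatt_qfact.
rewrite mulrCA -mulrA; congr (_ * _).
(* Row factors, column factors and the diagonal entries (q)_i combine index by index. *)
rewrite -!big_split /=; apply: eq_bigr => i _.
by field; rewrite !qfact_neq0.
Qed.

End QHoggattDeterminant.

Theorem theorem8 (R : realFieldType) (q : R) (d n k : nat)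
    (hq : 0 < `|q| < 1) (hd : (0 < d)%N) (hkn : (k <= n)%N) :
  qhoggatt d q n k =
    q ^- ('C(d, 2) * (n - k)) *
      \det (\matrix_(i < d, j < d) qbinom q (n + i) (k + j)).
Proof.
case/andP: hq; rewrite normr_gt0 => q_neq0 q_lt1.
have q_nroot i : (0 < i)%N -> q ^+ i != 1.
  (* If q^i = 1 then the absolute value of q has i-th power 1, so it is at least 1. *)
  move=> i_gt0; apply: contraTneq q_lt1 => qi1; rewrite -leNgt.
  by rewrite -(@expr_ge1 _ i) // -normrX qi1 normr1.
have := det_qbinom q_neq0 q_nroot d (n - k) k; rewrite subnK // => ->.
by rewrite mulKf ?expf_neq0.
Qed.
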